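(* Let $n\ge2$ and let $M\ne0$ be a real $n\times n$ matrix with $M^2=0$. Consider the linear geodesic $A(t)=I+tM$ in $\mathsf{SL}(n)$ with the HS metric. Then the Jacobi fields along $A$ are the fields of the explicit form \[J(t)=\left(\frac{|M|^2t}{n}I+M^T\right)b(t)+K_0+tK_1,\] where $K_0,K_1\in\ \perp_{I,M}$, and the scalar function $b$ is given, for free constants $b_0,b_1\in\mathbb{R}$, by \[b(t)=\frac{\sqrt n\,b_1}{|M|}\arctan\left(\frac{|M|t}{\sqrt n}\right)+b_0.\]
   Context: $\mathcal{M}(n)$ is the space of real $n\times n$ matrices with the Hilbert-Schmidt inner product $\langle A,B\rangle=\operatorname{tr}(AB^T)$ and norm $|A|=\sqrt{\langle A,A\rangle}$. The HS metric on $\mathsf{SL}(n)=\{A\in\mathcal{M}(n):\det A=1\}$ is the Riemannian metric induced on it as a submanifold of the Euclidean space $\mathcal{M}(n)$. For $B\in\mathsf{SL}(n)$ and $M$ nilpotent, $\perp_{B,M}:=\{Y\in\mathcal{M}(n)\mid \langle Y,B^{-T}(M^T)^k\rangle=0 \text{ for all } 0\le k<n\}$; thus here $\perp_{I,M}=\{Y: \operatorname{tr}Y=0,\ \langle Y,M^T\rangle=0\}$. Jacobi fields along a geodesic are the usual ones for the HS metric on $\mathsf{SL}(n)$, regarded as $\mathcal{M}(n)$-valued functions of $t$; they are the $\mathsf{SL}(n)$-tangent fields solving the linearization of the geodesic equation $A''=\frac{\operatorname{tr}(A'A^{-1}A'A^{-1})}{\operatorname{tr}(A^{-1}A^{-T})}A^{-T}$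 along $A$. *)

(* Defs.v *)
From mathcomp Require Import all_boot all_order all_algebra.
From mathcomp Require Import all_classical all_reals all_analysis.
Set Implicit Arguments.
Unset Strict Implicit.
Unset Printing Implicit Defensive.
Import Order.TTheory GRing.Theory Num.Theory.
Import numFieldNormedType.Exports.
Local Open Scope classical_set_scope.
Local Open Scope ring_scope.

(* Derivatives of matrix-valued maps use the library's (max-norm) topology on
   'M[R]_n, which agrees with the Hilbert-Schmidt one in finite dimension. *)

Definition hs_inner (R : realType) (n : nat) (A B : 'M[R]_n) : R :=
  \tr (A *m B^T).

Definition hs_norm (R : realType) (n : nat) (A : 'M[R]_n) : R :=
  Num.sqrt (hs_inner A A).

Definition SL (R : realType) (n : nat) : set 'M[R]_n :=
  [set A | \det A = 1].

(* T_A SL(n) is the kernel of the differential of \det at A; the value 1 is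
   regular, so this is the tangent space of the level set. *)
Definition tangent_SL (R : realType) (n : nat) (A : 'M[R]_n) : set 'M[R]_n :=
  [set V | is_derive A V (fun X : 'M[R]_n => \det X) 0].

(* A^-T is (invmx A)^T.  This is the right-hand side of A'' = F(A, A'); it is
   used only at (and, for derivatives, near) pairs whose first component is
   invertible, where invmx is the actual inverse. *)
Definition hs_spray (R : realType) (n : nat) (p : 'M[R]_n * 'M[R]_n) :
    'M[R]_n :=
  (\tr (p.2 *m invmx p.1 *m p.2 *m invmx p.1)
     / \tr (invmx p.1 *m (invmx p.1)^T)) *: (invmx p.1)^T.

Definition hs_geodesic (R : realType) (n : nat) (A : R -> 'M[R]_n) : Prop :=
  forall t : R,
    [/\ SL (A t),
        derivable A t 1,
        derivable (derive1 A) t 1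
      & derive1 (derive1 A) t = hs_spray (A t, derive1 A t)].

(* The last clause is the linearized equation J'' = DF(A, A')[J, J'], the
   differential being taken as the derivative at (A, A') along (J, J'). *)
Definition hs_jacobi_field (R : realType) (n : nat) (A J : R -> 'M[R]_n) :
    Prop :=
  forall t : R,
    [/\ tangent_SL (A t) (J t),
        derivable J t 1,
        derivable (derive1 J) t 1
      & is_derive (A t, derive1 A t) (J t, derive1 J t) (@hs_spray R n)
          (derive1 (derive1 J) t)].

Definition hs_perp (R : realType) (n : nat) (B M : 'M[R]_n) : set 'M[R]_n :=
  [set Y | forall k : nat, (k < n)%N ->
    hs_inner Y ((invmx B)^T *m (M^T) ^+ k) = 0].

(* Main.v *)
(* Along [A t = 1 + t M] one has [A^-1 = 1 - t M] and [M A^-1 = M], so the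
   numerator of the spray vanishes on [(A, A')] and the linearized equation is
   [J'' = 2 tr (J' M) / (n + c t ^ 2) (1 - t M^T)] with [c = |M| ^ 2], while
   tangency reads [tr J = t tr (J M)].  Taking the trace against [M] makes
   [(n + c t ^ 2) tr (J' M)] constant, so [tr (J M) = c b] with [b] an affine
   function of an arctangent; subtracting [(c t / n + M^T) b], which is itself
   a solution, leaves a field with zero second derivative. *)

Require Import Defs.
From mathcomp Require Import all_boot all_order all_algebra.
From mathcomp Require Import all_classical all_reals all_analysis.
From mathcomp Require Import perm ring.
Import Order.TTheory GRing.Theory Num.Theory.
Import numFieldNormedType.Exports.
Local Open Scope classical_set_scope.
Local Open Scope ring_scope.

Set Implicit Arguments.
Unset Strict Implicit.
Unset Printing Implicit Defensive.

(** * Directional derivatives of matrix-valued maps *)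

(** The two difference quotients coincide. This moves derivatives of [\det] and [hs_spray] on matrix
    spaces to one real variable, where the rules for inverses apply. *)
Lemma is_derive_lineP (R : numFieldType) (V W : normedModType R)
    (f : V -> W) (x v : V) (df : W) :
  is_derive x v f df <-> is_derive (0 : R) 1 (fun h => f (h *: v + x)) df.
Proof.
have dE : 'D_1 (fun h : R => f (h *: v + x)) 0 = 'D_v f x.
  rewrite /derive; set g1 := fun h => h^-1 *: _; set g2 := fun h => h^-1 *: _.
  suff -> : g1 = g2 by [].
  by rewrite funeqE /g1 /g2 => h /=; rewrite addr0 scale0r add0r [_%:A]mulr1.
split=> -[fx <-].
  by split=> //; exact/(derivable1P f x v).1.
by split=> //; exact/(derivable1P f x v).2.
Qed.

Lemma is_derive_bigsum (R : numFieldType) (V W : normedModType R) (I : Type)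
    (r : seq I) (h : I -> V -> W) (x v : V) (dh : I -> W) :
  (forall i, is_derive x v (h i) (dh i)) ->
  is_derive x v (fun y => \sum_(i <- r) h i y) (\sum_(i <- r) dh i).
Proof.
move=> hx; elim: r => [|i r IHr].
  by under eq_fun do rewrite big_nil; rewrite big_nil; exact: is_derive_cst.
by under eq_fun do rewrite big_cons; rewrite big_cons; exact: is_deriveD.
Qed.

Lemma is_derive_mxP (R : realFieldType) (V : normedModType R) (m n : nat)
    (f : V -> 'M[R]_(m, n)) (x v : V) (df : 'M[R]_(m, n)) :
  is_derive x v f df <->
  forall i j, is_derive x v (fun y => f y i j) (df i j).
Proof.
split=> [[fx <-] i j|fx].
  by split; [exact: (derivable_mxP f x v).1|rewrite derive_mx// mxE].
have fx' : derivable f x v by apply/derivable_mxP => i j; case: (fx i j).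
split=> //; rewrite derive_mx//; apply/matrixP => i j; rewrite mxE.
by case: (fx i j).
Qed.

Lemma is_derive_mulmx (R : realFieldType) (V : normedModType R) (m n p : nat)
    (f : V -> 'M[R]_(m, n)) (g : V -> 'M[R]_(n, p)) (x v : V) df dg :
  is_derive x v f df -> is_derive x v g dg ->
  is_derive x v (fun y => f y *m g y) (df *m g x + f x *m dg).
Proof.
move=> /is_derive_mxP fx /is_derive_mxP gx; apply/is_derive_mxP => i j.
under eq_fun do rewrite mxE.
rewrite 3!mxE -big_split /=; refine (is_derive_bigsum _ _) => k.
apply: is_derive_eq (is_deriveM (fx i k) (gx k j)) _.
by rewrite addrC; congr (_ + _); exact: mulrC.
Qed.

Lemma is_derive_trmx (R : realFieldType) (V : normedModType R) (m n : nat)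
    (f : V -> 'M[R]_(m, n)) (x v : V) df :
  is_derive x v f df -> is_derive x v (fun y => (f y)^T) df^T.
Proof.
move=> /is_derive_mxP fx; apply/is_derive_mxP => i j; rewrite mxE.
by under eq_fun do rewrite mxE.
Qed.

Lemma is_derive_mxtrace (R : realFieldType) (V : normedModType R) (n : nat)
    (f : V -> 'M[R]_n) (x v : V) df :
  is_derive x v f df -> is_derive x v (fun y => \tr (f y)) (\tr df).
Proof.
move=> /is_derive_mxP fx.
exact: is_derive_bigsum.
Qed.

Lemma is_derive_scalemx (R : realFieldType) (V : normedModType R) (m n : nat)
    (k : V -> R) (f : V -> 'M[R]_(m, n)) (x v : V) dk df :
  is_derive x v k dk -> is_derive x v f df ->
  is_derive x v (fun y => k y *: f y) (dk *: f x + k x *: df).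
Proof.
move=> kx /is_derive_mxP fx; apply/is_derive_mxP => i j.
have -> : (fun y => (k y *: f y) i j) = k * (fun y => f y i j).
  by apply/funext => y; rewrite mxE.
apply: is_derive_eq (is_deriveM kx (fx i j)) _.
by rewrite !mxE addrC; congr (_ + _); exact: mulrC.
Qed.

Lemma is_derive_line (R : numFieldType) (V : normedModType R) (a v : V)
    (t : R) :
  is_derive t 1 (fun s => a + s *: v) v.
Proof.
have -> : (fun s => a + s *: v) = cst a + ( *:%R^~ v) by [].
apply: is_derive_eq
  (is_deriveD (is_derive_cst _ _ _) (_ : is_derive _ _ _ v)) _.
  have dv : is_diff t ( *:%R^~ v) ( *:%R^~ v) by exact: is_diff_scalel.
  split; first exact: diff_derivable.
  by rewrite deriveE// diff_val scale1r.
by rewrite add0r.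
Qed.

Lemma derivable_prod (R : numFieldType) (V : normedModType R) (I : Type)
    (r : seq I) (F : I -> V -> R) (x v : V) :
  (forall i, derivable (F i) x v) ->
  derivable (fun y => \prod_(i <- r) F i y) x v.
Proof.
move=> Fx; elim: r => [|i r IHr].
  by under eq_fun do rewrite big_nil; exact: derivable_cst.
under eq_fun do rewrite big_cons.
exact: derivableM.
Qed.

(** The Leibniz expansion is a finite sum of products of entries. *)
Lemma derivable_det (R : realFieldType) (V : normedModType R) (n : nat)
    (f : V -> 'M[R]_n) (x v : V) :
  derivable f x v -> derivable (fun y => \det (f y)) x v.
Proof.
move=> /derivable_mxP fx.
have dprod s : derivable
    (fun y => (-1) ^+ (s : 'S_n) * \prod_i f y i (s i) : R) x v.
  by apply: derivableM; [exact: derivable_cst|exact: derivable_prod].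
by have [] := is_derive_bigsum (index_enum _) (fun s => derivableP (dprod s)).
Qed.

Lemma derivable_adj (R : realFieldType) (V : normedModType R) (n : nat)
    (f : V -> 'M[R]_n) (x v : V) :
  derivable f x v -> derivable (fun y => \adj (f y)) x v.
Proof.
move=> /derivable_mxP fx; apply/derivable_mxP => i j.
under eq_fun do rewrite mxE /cofactor.
apply: derivableM; first exact: derivable_cst.
apply/derivable_det/derivable_mxP => k l.
by under eq_fun do rewrite !mxE; exact: fx.
Qed.
 
(** Cramer's formula gives derivability; the value then follows by differentiating
    [invmx (f y) *m f y = 1] and solving for the unknown term. *)
Lemma is_derive_invmx (R : realFieldType) (n : nat) (f : R -> 'M[R]_n)
    (x : R) df :
  f x \in unitmx -> is_derive x 1 f df ->
  is_derive x 1 (fun y => invmx (f y)) (- (invmx (f x) *m df *m invmx (f x))).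
Proof.
move=> fxU fdf; have [fx _] := fdf.
have ddet := derivable_det fx.
have detx0 : \det (f x) != 0 by rewrite -unitfE -unitmxE.
(* Both Cramer's formula and [mulVmx] require an invertible matrix, since [invmx] is the identity on
   singular ones; continuity of the determinant secures this near [x]. *)
have near_unit : \forall y \near x, f y \in unitmx.
  have /differentiable_continuous cdet := (derivable1_diffP _ _).1 ddet.
  have : \forall y \near x, \det (f y) != 0.
    exact: cvgr_neq0 cdet detx0.
  by apply: filterS => y; rewrite unitmxE unitfE.
have dV : derivable (fun y => (\det (f y))^-1) x 1 by exact: derivableV.
have dZ : derivable (fun y => (\det (f y))^-1 *: \adj (f y)) x 1.
  have dadj := derivableP (derivable_adj fx).
  by have [] := is_derive_scalemx (derivableP dV) dadj.
have dinv : derivable (fun y => invmx (f y)) x 1.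
  apply: near_eq_derivable dZ; apply: filterS near_unit => y fyU.
  by rewrite /invmx fyU.
have [_ dprod] := is_derive_mulmx (derivableP dinv) fdf.
have [_ d1] : is_derive x (1 : R) (fun y => invmx (f y) *m f y) 0.
  apply: near_eq_is_derive (is_derive_cst (1%:M : 'M[R]_n) x 1).
  by apply: filterS near_unit => y fyU; rewrite mulVmx.
split=> //; move: dprod; rewrite d1 => /esym/eqP; rewrite addr_eq0 => /eqP DE.
by rewrite -[LHS](mulmxK fxU) DE mulNmx.
Qed.

(** * Trace of a square-zero matrix and Jacobi's formula for the determinant *)

(** Rank factorization [M = C *m B]: as [C] has full column rank and [B] full row rank, both cancel
    from [C B C B = 0], leaving [B C = 0]; and [C B] has the same trace as [B C]. *)
Lemma mxtrace_square0 (F : fieldType) (n : nat) (M : 'M[F]_n) :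
  M *m M = 0 -> \tr M = 0.
Proof.
move: (\rank M) (col_base M) (row_base M) (mulmx_base M)
  (col_base_full M) (row_base_free M) => r C B <- fullC freeB CBCB.
have BC0 : B *m C = 0.
  apply: (row_full_inj fullC); apply: (row_free_inj freeB).
  by rewrite mulmx0 mul0mx -CBCB !mulmxA.
by rewrite mxtrace_mulC BC0 mxtrace0.
Qed.

(* For [h != 0], [\det (1 + h X) = h ^ n * chi_{-X} (1 / h)]: it is the
   reciprocal of the characteristic polynomial of [- X]. *)
Lemma det_addZ1_horner (F : fieldType) (n : nat) (X : 'M[F]_n) (h : F) :
  \det (h *: X + 1%:M) =
  (\poly_(k < n.+1) (char_poly (- X))`_(n - k)).[h].
Proof.
set p := char_poly (- X).
have szp : size p = n.+1 by exact: size_char_poly.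
rewrite horner_poly; have [->|h0] := eqVneq h 0.
  (* At [h = 0] only the constant coefficient survives; it is the leading coefficient of the monic
     [p]. *)
  rewrite scale0r add0r det1 big_ord_recl big1 => [|i _].
    rewrite subn0 expr0 mulr1 addr0.
    by have /monicP := char_poly_monic (- X); rewrite /lead_coef -/p szp.
  by rewrite lift0 expr0n mulr0.
have -> : h *: X + 1%:M = h *: (h^-1%:M + X).
  by rewrite scalerDr scale_scalar_mx mulfV// addrC.
rewrite detZ.
have -> : \det (h^-1%:M + X) = p.[h^-1].
  rewrite -horner_evalE -det_map_mx; congr (\det _).
  apply/matrixP => i j.
  by rewrite !mxE /= ?/horner_eval !(hornerE, hornerMn) opprK.
rewrite horner_coef szp (reindex_inj rev_ord_inj) mulr_sumr.
apply: eq_bigr => k _; rewrite /= subSS mulrCA; congr (_ * _).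
have kn : (k <= n)%N by rewrite -ltnS.
by rewrite exprVn -{1}(subnK kn) exprD mulrAC divff ?mul1r// expf_neq0.
Qed.

(** The derivative at 0 is the linear coefficient of the reciprocal polynomial, that is the
    coefficient of degree [n - 1] of [char_poly (- X)], which is minus the trace of [- X]. *)
Lemma is_derive_det_1 (R : realFieldType) (n : nat) (X : 'M[R]_n) :
  (0 < n)%N -> is_derive (0 : R) 1 (fun h => \det (h *: X + 1%:M)) (\tr X).
Proof.
move=> n0; under eq_fun do rewrite det_addZ1_horner.
apply: is_derive_eq (is_derive_poly _ _) _.
rewrite horner_coef0 coef_deriv coef_poly ltnS n0 subn1 char_poly_trace//.
by rewrite raddfN opprK.
Qed.

(** Jacobi's formula, reduced to the identity matrix by factoring [A] out of [A + h V]. *)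
Lemma is_derive_det (R : realFieldType) (n : nat) (A V : 'M[R]_n) :
  (0 < n)%N -> A \in unitmx ->
  is_derive A V (fun X : 'M[R]_n => \det X) (\det A * \tr (invmx A *m V)).
Proof.
move=> n0 AU; apply/is_derive_lineP.
have -> : (fun h : R => \det (h *: V + A)) =
    (fun h : R => \det A * \det (h *: (invmx A *m V) + 1%:M)).
  apply/funext => h; rewrite -det_mulmx mulmxDr mulmx1 -scalemxAr mulmxA.
  by rewrite mulmxV// mul1mx.
exact: is_deriveZ (is_derive_det_1 _ n0).
Qed.

(** * Inverse, tangent space and linearized spray along [1 + t M] *)

Lemma mulmx_line_inv (R : comUnitRingType) (n : nat) (M : 'M[R]_n) (t : R) :
  M *m M = 0 -> (1%:M + t *: M) *m (1%:M - t *: M) = 1%:M.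
Proof.
move=> M2; rewrite mulmxDl mul1mx mulmxBr mulmx1 -scalemxAl -scalemxAr M2.
by rewrite !scaler0 subr0 subrK.
Qed.

Lemma unitmx_line (R : comUnitRingType) (n : nat) (M : 'M[R]_n) (t : R) :
  M *m M = 0 -> 1%:M + t *: M \in unitmx.
Proof. by move=> /(mulmx_line_inv t)/mulmx1_unit[]. Qed.

Lemma invmx_line (R : comUnitRingType) (n : nat) (M : 'M[R]_n) (t : R) :
  M *m M = 0 -> invmx (1%:M + t *: M) = 1%:M - t *: M.
Proof.
move=> M2; have := congr1 (mulmx (invmx (1%:M + t *: M))) (mulmx_line_inv t M2).
by rewrite mulKmx ?unitmx_line// mulmx1 => ->.
Qed.

(** By Jacobi's formula the derivative in [t] is the trace of [(1 - t M) M = M], which is 0; so the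
    determinant keeps its value at [t = 0]. *)
Lemma det_line (R : realType) (n : nat) (M : 'M[R]_n) (t : R) :
  (0 < n)%N -> M *m M = 0 -> \det (1%:M + t *: M) = 1.
Proof.
move=> n0 M2; rewrite -[RHS](det1 R n) -[1%:M in RHS]addr0 -(scale0r M).
apply: (is_derive_0_is_cst (f := fun s => \det (1%:M + s *: M))) => {}t.
apply/is_derive_lineP.
have /is_derive_lineP := is_derive_det M n0 (unitmx_line t M2).
rewrite invmx_line// mulmxBl mul1mx -scalemxAl M2 scaler0 subr0.
rewrite mxtrace_square0// mulr0; congr (is_derive _ _ _ _).
by apply/funext => h; rewrite scalerDl [_%:A]mulr1 addrCA.
Qed.

Lemma tangent_SL_line (R : realType) (n : nat) (M V : 'M[R]_n) (t : R) :
  (0 < n)%N -> M *m M = 0 ->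
  tangent_SL (1%:M + t *: M) V <-> \tr V = t * \tr (V *m M).
Proof.
move=> n0 M2; have := is_derive_det V n0 (unitmx_line t M2).
rewrite det_line// mul1r invmx_line// mulmxBl mul1mx -scalemxAl.
rewrite raddfB/= mxtraceZ mxtrace_mulC => dV.
split=> [[_]|trV].
  by case: dV => _ -> /eqP; rewrite subr_eq0 => /eqP.
by rewrite /tangent_SL /=; move: dV; rewrite trV subrr.
Qed.

Lemma trmx_1BZ (R : comUnitRingType) (n : nat) (M : 'M[R]_n) (t : R) :
  (1%:M - t *: M)^T = 1%:M - t *: M^T.
Proof. by apply/matrixP => i j; rewrite !mxE eq_sym. Qed.

Lemma mxtrace_invmx_line (R : realType) (n : nat) (M : 'M[R]_n) (t : R) :
  M *m M = 0 ->
  \tr (invmx (1%:M + t *: M) *m (invmx (1%:M + t *: M))^T) =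
  n%:R + t ^+ 2 * hs_inner M M.
Proof.
move=> M2; rewrite invmx_line// trmx_1BZ mulmxBl mul1mx.
rewrite mulmxBr mulmx1 -scalemxAl -scalemxAr !raddfB /= !mxtraceZ mxtrace1.
rewrite mxtrace_tr mxtrace_square0// mulr0 subr0 oppr0 sub0r opprK.
by rewrite mulrA -expr2.
Qed.

Lemma hs_inner_gt0 (R : realType) (n : nat) (M : 'M[R]_n) :
  M != 0 -> 0 < hs_inner M M.
Proof.
move=> M0; have innerE : hs_inner M M = \sum_i \sum_j M i j ^+ 2.
  apply: eq_bigr => i _; rewrite mxE; apply: eq_bigr => j _.
  by rewrite mxE expr2.
rewrite innerE lt_neqAle eq_sym; apply/andP; split; last first.
  by apply: sumr_ge0 => i _; apply: sumr_ge0 => j _; exact: sqr_ge0.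
apply: contra M0 => /eqP/psumr_eq0P M0; apply/eqP/matrixP => i j.
have /psumr_eq0P M0i : \sum_j M i j ^+ 2 = 0.
  by apply: M0 => // k _; apply: sumr_ge0 => l _; exact: sqr_ge0.
apply/eqP; rewrite mxE -sqrf_eq0; apply/eqP.
by apply: M0i => // k _; exact: sqr_ge0.
Qed.

Lemma hs_spray_line (R : realType) (n : nat) (M : 'M[R]_n) (t : R) :
  M *m M = 0 -> hs_spray (1%:M + t *: M, M) = 0.
Proof.
move=> M2; have MB : M *m (1%:M - t *: M) = M.
  by rewrite mulmxBr mulmx1 -scalemxAr M2 scaler0 subr0.
by rewrite /hs_spray /= invmx_line// MB M2 mul0mx mxtrace0 mul0r scale0r.
Qed.

(* The numerator of the spray vanishes at [(1 + t M, M)], so only its own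
   derivative contributes to that of the quotient. *)
Lemma is_derive_hs_spray_line (R : realType) (n : nat) (M J K : 'M[R]_n)
    (t : R) :
  (0 < n)%N -> M *m M = 0 ->
  is_derive (1%:M + t *: M, M) (J, K) (@hs_spray R n)
    (2 * \tr (K *m M) / (n%:R + t ^+ 2 * hs_inner M M)
       *: (1%:M - t *: M^T)).
Proof.
move=> n0 M2; set A := 1%:M + t *: M; apply/is_derive_lineP.
have AU : A \in unitmx by exact: unitmx_line.
have den_gt0 : 0 < n%:R + t ^+ 2 * hs_inner M M.
  rewrite ltr_pwDl ?ltr0n// mulr_ge0 ?sqr_ge0//.
  have [->|/hs_inner_gt0/ltW//] := eqVneq M 0.
  by rewrite /hs_inner mul0mx mxtrace0.
have lineP (X V : 'M[R]_n) : is_derive (0 : R) 1 (fun h => h *: V + X) V.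
  by under eq_fun do rewrite addrC; exact: is_derive_line.
have A0 : 0 *: J + A = A by rewrite scale0r add0r.
have M0 : 0 *: K + M = M by rewrite scale0r add0r.
have dG : is_derive (0 : R) 1 (fun h => invmx (h *: J + A))
    (- (invmx A *m J *m invmx A)).
  have := @is_derive_invmx R n (fun h => h *: J + A) 0 J; rewrite A0.
  by apply.
have := is_derive_mulmx (is_derive_mulmx (is_derive_mulmx (lineP M K) dG)
  (lineP M K)) dG.
move/is_derive_mxtrace; rewrite A0 M0 /A invmx_line// -/A.
set B := 1%:M - t *: M => dnum.
have MB : M *m B = M by rewrite mulmxBr mulmx1 -scalemxAr M2 scaler0 subr0.
have BM : B *m M = M by rewrite mulmxBl mul1mx -scalemxAl M2 scaler0 subr0.
(* With [M B = B M = M], one term in [J] dies from [M B M = 0] and the other becomes [M J M], of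
   trace 0; each of the two terms in [K] contributes [\tr (K *m M)]. *)
have trE : \tr (((K *m B + M *m - (B *m J *m B)) *m M + M *m B *m K) *m B +
     M *m B *m M *m - (B *m J *m B)) = 2 * \tr (K *m M).
  rewrite MB M2 mul0mx addr0 mulmxN !mulmxA MB mulmxDl mulmxBl.
  rewrite -[K *m B *m M]mulmxA BM -[M *m J *m B *m M]mulmxA BM mulmxBl.
  rewrite -[K *m M *m B]mulmxA MB -[M *m J *m M *m B]mulmxA MB.
  have trMJM : \tr (M *m J *m M) = 0.
    by rewrite mxtrace_mulC mulmxA M2 mul0mx mxtrace0.
  have trMKB : \tr (M *m K *m B) = \tr (K *m M).
    by rewrite mxtrace_mulC mulmxA BM mxtrace_mulC.
  by rewrite mxtraceD raddfB /= trMJM trMKB subr0 mulr_natl mulr2n.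
rewrite trE in dnum.
have dden := is_derive_mxtrace (is_derive_mulmx dG (is_derive_trmx dG)).
have [ddenV _] := dden.
pose G h := invmx (h *: J + A).
pose num h := \tr ((h *: K + M) *m G h *m (h *: K + M) *m G h).
pose den h := \tr (G h *m (G h)^T).
have GE : G 0 = B by rewrite /G A0 /A invmx_line.
have num0 : num 0 = 0 by rewrite /num GE M0 MB M2 mul0mx mxtrace0.
have denE : den 0 = n%:R + t ^+ 2 * hs_inner M M.
  by rewrite /den /G A0 /A mxtrace_invmx_line.
have dV : derivable (fun h => (den h)^-1) 0 1.
  by apply: derivableV ddenV; rewrite -/(den 0) denE gt_eqF.
have dk : is_derive (0 : R) 1 (fun h => num h * (den h)^-1)
    (2 * \tr (K *m M) / (n%:R + t ^+ 2 * hs_inner M M)).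
  have dnum' : is_derive (0 : R) 1 num (2 * \tr (K *m M)) by [].
  apply: is_derive_eq (is_deriveM dnum' (derivableP dV)) _.
  by rewrite num0 scale0r add0r denE [LHS]mulrC.
apply: is_derive_eq (is_derive_scalemx dk (is_derive_trmx dG)) _.
by rewrite -/(G 0) GE trmx_1BZ num0 mul0r scale0r addr0.
Qed.

(** * Geodesic and Jacobi equations along the line *)

Lemma derive1_line (R : realType) (n : nat) (M : 'M[R]_n) :
  derive1 (fun t : R => 1%:M + t *: M) = cst M.
Proof.
apply/funext => t; rewrite derive1E.
by have [_ ->] := is_derive_line (1%:M : 'M[R]_n) M t.
Qed.

Lemma line_geodesic (R : realType) (n : nat) (M : 'M[R]_n) :
  (0 < n)%N -> M *m M = 0 -> hs_geodesic (fun t : R => 1%:M + t *: M).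
Proof.
move=> n0 M2 t; rewrite derive1_line; split.
- exact: det_line.
- by have [] := is_derive_line (1%:M : 'M[R]_n) M t.
- exact: derivable_cst.
- by rewrite derive1_cst hs_spray_line.
Qed.

(** Makes the Jacobi system explicit: left to right by uniqueness of the directional derivative of
    the spray, right to left by its existence. *)
Lemma hs_jacobi_lineP (R : realType) (n : nat) (M : 'M[R]_n)
    (J : R -> 'M[R]_n) :
  (0 < n)%N -> M *m M = 0 ->
  hs_jacobi_field (fun t => 1%:M + t *: M) J <->
  forall t,
    [/\ \tr (J t) = t * \tr (J t *m M),
        derivable J t 1,
        derivable (derive1 J) t 1
      & derive1 (derive1 J) t =
          2 * \tr (derive1 J t *m M) / (n%:R + t ^+ 2 * hs_inner M M)
            *: (1%:M - t *: M^T)].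
Proof.
move=> n0 M2; split=> JJ t; have [] := JJ t; rewrite ?derive1_line.
  move=> /(tangent_SL_line _ _ n0 M2) trJ J1 J2 [_ J3].
  have [_ dS] := is_derive_hs_spray_line (J t) (derive1 J t) t n0 M2.
  by split; [exact: trJ|exact: J1|exact: J2|rewrite -J3 -dS].
move=> /(tangent_SL_line _ _ n0 M2) trJ J1 J2 J3.
split; [exact: trJ|exact: J1|exact: J2|rewrite J3].
exact: is_derive_hs_spray_line.
Qed.

(** Powers of [M^T] from the second on vanish, and [2 <= n] ensures that the exponents 0 and 1 both
    occur. *)
Lemma hs_perp1P (R : realType) (n : nat) (M Y : 'M[R]_n) :
  (2 <= n)%N -> M *m M = 0 ->
  hs_perp 1%:M M Y <-> \tr Y = 0 /\ \tr (Y *m M) = 0.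
Proof.
move=> n2 M2.
have invT : (invmx (1%:M : 'M[R]_n))^T = 1%:M by rewrite invmx1 trmx1.
have hs0 : hs_inner Y (1%:M *m M^T ^+ 0) = \tr Y.
  by rewrite expr0 mul1mx /hs_inner trmx1 mulmx1.
have hs1 : hs_inner Y (1%:M *m M^T ^+ 1) = \tr (Y *m M).
  by rewrite expr1 mul1mx /hs_inner trmxK.
rewrite /hs_perp /= invT; split=> [YM|[Y0 YM0] [_|[_|k _]]].
- by rewrite -hs0 -hs1 !YM// ltnW.
- by rewrite hs0.
- by rewrite hs1.
- have -> : M^T ^+ k.+2 = 0.
    by rewrite 2!exprS mulrA -[M^T * M^T]trmx_mul M2 trmx0 mul0r.
  by rewrite mulmx0 /hs_inner trmx0 mulmx0 mxtrace0.
Qed.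

(** * Solving the Jacobi equation *)

(** Entry by entry, constancy from a zero derivative is used twice: for [f1], then for
    [f s - s f1 0]. *)
Lemma second_derive0_affine (R : realType) (m n : nat)
    (f f1 : R -> 'M[R]_(m, n)) :
  (forall t : R, is_derive t 1 f (f1 t)) ->
  (forall t : R, is_derive t 1 f1 0) ->
  forall t, f t = f 0 + t *: f1 0.
Proof.
move=> df df1 t; apply/matrixP => i j.
have f1E s : f1 s i j = f1 0 i j.
  apply: (is_derive_0_is_cst (f := fun s => f1 s i j)) => u.
  by have /is_derive_mxP/(_ i j) := df1 u; rewrite mxE.
have dg u : is_derive u (1 : R) (fun s => f s i j - s * f1 0 i j) 0.
  have /is_derive_mxP/(_ i j) dfu := df u.
  apply: is_derive_eq (is_deriveB dfu (is_deriveM (is_derive_id u (1 : R))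
    (is_derive_cst (f1 0 i j) u (1 : R)))) _.
  by rewrite f1E scaler0 add0r [_ *: _]mulr1 subrr.
have := is_derive_0_is_cst t 0 dg.
by rewrite mul0r subr0 !mxE => <-; rewrite subrK.
Qed.

Lemma is_derive_growth (R : realType) (a c t : R) :
  is_derive t 1 (fun s => a + s ^+ 2 * c) (2 * t * c).
Proof.
under eq_fun do rewrite expr2.
have did := is_derive_id t (1 : R).
apply: is_derive_eq (is_deriveD (is_derive_cst a t (1 : R))
  (is_deriveM (is_deriveM did did) (is_derive_cst c t (1 : R)))) _.
rewrite scaler0 !add0r /= [c *: _]mulrC -[t *: _]/(t * 1) !mulr1.
by rewrite mulr_natl mulr2n.
Qed.

(** Meant for [s = sqrt n] and [m = |M|], where the derivative is [b1 n / (n + |M|^2 t^2)]; thus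
    [b1] is the initial slope of [b]. *)
Lemma is_derive_atan_profile (R : realType) (s m b0 b1 t : R) :
  0 < s -> 0 < m ->
  is_derive t 1 (fun u => s * b1 / m * atan (m * u / s) + b0)
    (b1 * s ^+ 2 / (s ^+ 2 + t ^+ 2 * m ^+ 2)).
Proof.
move=> s0 m0.
have dlin : is_derive t (1 : R) (fun u => m * u / s) (m / s).
  apply: is_derive_eq (is_deriveM (is_deriveM (is_derive_cst m t (1 : R))
    (is_derive_id t (1 : R))) (is_derive_cst s^-1 t (1 : R))) _.
  by rewrite !scaler0 addr0 add0r [_ *: 1]mulr1 [_ *: _]mulrC.
have datan := @is_derive1_comp R atan _ t _ _ (is_derive1_atan _) dlin.
apply: is_derive_eq (is_deriveD (is_deriveM
  (is_derive_cst (s * b1 / m) t (1 : R)) datan)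
  (is_derive_cst b0 t (1 : R))) _.
rewrite scaler0 !addr0 /= -[_ *: _]/(_ * _).
have pos : 0 < s ^+ 2 + t ^+ 2 * m ^+ 2.
  by rewrite ltr_pwDl ?exprn_gt0// mulr_ge0// sqr_ge0.
have -> : 1 + (m * t / s) ^+ 2 = (s ^+ 2 + t ^+ 2 * m ^+ 2) / s ^+ 2.
  by field; rewrite gt_eqF.
by field; rewrite exprMn !gt_eqF.
Qed.

(* Differentiating the ansatz [b (M^T + t c / n)] twice, for any [b] with
   [b' = b1 n / (n + c t ^ 2)], reproduces the right-hand side of the
   linearized equation. *)
Lemma is_derive_ansatz (R : realType) (n : nat) (M : 'M[R]_n) (b : R -> R)
    (b1 c t : R) (b' := fun u => b1 * n%:R / (n%:R + u ^+ 2 * c)) :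
  (0 < n)%N -> 0 < c -> (forall u : R, is_derive u 1 b (b' u)) ->
  is_derive t 1
    (fun u => b' u *: (M^T + u *: (c / n%:R)%:M) + b u *: (c / n%:R)%:M)
    (2 * (b' t * c) / (n%:R + t ^+ 2 * c) *: (1%:M - t *: M^T)).
Proof.
move=> n0 c0 db.
have pos u : 0 < n%:R + u ^+ 2 * c.
  by rewrite ltr_pwDl ?ltr0n// mulr_ge0 ?sqr_ge0// ltW.
have db' : is_derive t (1 : R) b'
    (- (b1 * n%:R * (2 * t * c) / (n%:R + t ^+ 2 * c) ^+ 2)).
  have dV := @is_deriveV R _ t _ _ (lt0r_neq0 (pos t))
    (is_derive_growth n%:R c t).
  apply: is_derive_eq (is_deriveM (is_derive_cst (b1 * n%:R) t (1 : R)) dV) _.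
  rewrite scaler0 addr0 /= -[_ *: _]/(_ * (_ * _)).
  by field; rewrite gt_eqF.
have dD := is_derive_scalemx (db t)
  (is_derive_cst ((c / n%:R)%:M : 'M[R]_n) t (1 : R)).
apply: is_derive_eq
  (is_deriveD (is_derive_scalemx db' (is_derive_line _ _ _)) dD) _.
have n_neq0 : n%:R != 0 :> R by rewrite pnatr_eq0 -lt0n.
(* Diagonal and off-diagonal entries give two separate rational identities, as the scalar matrices
   contribute only on the diagonal. *)
apply/matrixP => i j; rewrite !mxE /b'; case: (i == j); rewrite ?mulr1n ?mulr0n.
  by field; rewrite n_neq0 gt_eqF.
by field; rewrite gt_eqF.
Qed.
(** The scalar parts drop out because [\tr M = 0]. The form covers both the ansatz ([z = 0]) and its
    first derivative. *)
Lemma mxtrace_ansatz_mul (R : realType) (n : nat) (M : 'M[R]_n) (x y z : R) :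
  M *m M = 0 ->
  \tr ((x *: (M^T + y%:M) + z%:M) *m M) = x * hs_inner M M.
Proof.
move=> M2; rewrite mulmxDl -scalemxAl mulmxDl !mul_scalar_mx.
rewrite mxtraceD !mxtraceZ mxtraceD mxtraceZ (mxtrace_square0 M2) !mulr0 !addr0.
by rewrite mxtrace_mulC.
Qed.

Theorem proposition3p10 (R : realType) (n : nat) (hn : (2 <= n)%N)
    (M : 'M[R]_n) (hM0 : M != 0) (hM2 : M *m M = 0) :
  let A : R -> 'M[R]_n := fun t => 1%:M + t *: M in
  hs_geodesic A /\
  forall J : R -> 'M[R]_n,
    hs_jacobi_field A J <->
    exists (b0 b1 : R) (K0 K1 : 'M[R]_n),
      let b : R -> R := fun t =>
        Num.sqrt n%:R * b1 / hs_norm M * atan (hs_norm M * t / Num.sqrt n%:R)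
        + b0 in
      [/\ hs_perp 1%:M M K0,
          hs_perp 1%:M M K1
        & forall t : R,
            J t = b t *: ((hs_norm M ^+ 2 * t / n%:R)%:M + M^T)
                  + K0 + t *: K1].
Proof.
have n0 : (0 < n)%N by exact: ltnW.
move=> A; split=> [|J]; first exact: line_geodesic.
apply: (iff_trans (hs_jacobi_lineP J n0 hM2)).
pose c := hs_inner M M; have c0 : 0 < c by exact: hs_inner_gt0.
have nR0 : (0 : R) < n%:R by rewrite ltr0n.
have m2 : hs_norm M ^+ 2 = c by rewrite sqr_sqrtr// ltW.
have m0 : 0 < hs_norm M by rewrite sqrtr_gt0.
have s2 : Num.sqrt (n%:R : R) ^+ 2 = n%:R by rewrite sqr_sqrtr// ltW.
have s0 : 0 < Num.sqrt (n%:R : R) by rewrite sqrtr_gt0.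
pose b (b0 b1 t : R) : R := Num.sqrt n%:R * b1 / hs_norm M *
  atan (hs_norm M * t / Num.sqrt n%:R) + b0.
pose b' b1 t := b1 * n%:R / (n%:R + t ^+ 2 * c).
have db b0 b1 t : is_derive t (1 : R) (b b0 b1) (b' b1 t).
  by have := is_derive_atan_profile b0 b1 t s0 m0; rewrite s2 m2.
pose D : 'M[R]_n := (c / n%:R)%:M.
pose E b0 b1 t : 'M[R]_n := b b0 b1 t *: (M^T + t *: D).
pose E1 b0 b1 t : 'M[R]_n := b' b1 t *: (M^T + t *: D) + b b0 b1 t *: D.
have EE b0 b1 t :
    b b0 b1 t *: ((hs_norm M ^+ 2 * t / n%:R)%:M + M^T) = E b0 b1 t.
  rewrite /E scale_scalar_mx addrC m2; congr (_ *: (_ + _%:M)).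
  by rewrite mulrA [t * c]mulrC.
have dE b0 b1 t : is_derive t (1 : R) (E b0 b1) (E1 b0 b1 t).
  exact: is_derive_scalemx (db b0 b1 t) (is_derive_line _ _ _).
have dE1 b0 b1 t : is_derive t (1 : R) (E1 b0 b1)
    (2 * (b' b1 t * c) / (n%:R + t ^+ 2 * c) *: (1%:M - t *: M^T)).
  exact: is_derive_ansatz n0 c0 (db b0 b1).
have trEM b0 b1 t : \tr (E b0 b1 t *m M) = b b0 b1 t * c.
  have := mxtrace_ansatz_mul (b b0 b1 t) (t * (c / n%:R)) 0 hM2.
  by rewrite -[(0 : R)%:M]/0%:M raddf0 addr0 -scale_scalar_mx.
have trE1M b0 b1 t : \tr (E1 b0 b1 t *m M) = b' b1 t * c.
  by rewrite /E1 /D !scale_scalar_mx; exact: mxtrace_ansatz_mul.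
(* Tangency of the ansatz fixes the factor [c / n]: the identity has trace [n], so the scalar part
   has trace [t c b]. *)
have trE b0 b1 t : \tr (E b0 b1 t) = t * \tr (E b0 b1 t *m M).
  rewrite trEM /E mxtraceZ mxtraceD mxtraceZ mxtrace_tr (mxtrace_square0 hM2).
  rewrite add0r mxtrace_scalar -[_ *+ n]mulr_natr divfK ?gt_eqF//.
  by rewrite mulrCA.
split=> [JJ|[b0 [b1 [K0 [K1 [/(hs_perp1P _ hn hM2)[trK0 trK0M]
    /(hs_perp1P _ hn hM2)[trK1 trK1M] JE]]]]]]; last first.
  (* Sufficiency: the ansatz solves the system, and the affine part has no second derivative and is
     traceless, also against [M]. *)
  have {JE} -> : J = fun t => E b0 b1 t + (K0 + t *: K1).
    by apply/funext => t; rewrite JE -addrA -EE.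
  have dJ t : is_derive t (1 : R) (fun t => E b0 b1 t + (K0 + t *: K1))
      (E1 b0 b1 t + K1).
    exact: is_deriveD (dE b0 b1 t) (is_derive_line _ _ _).
  have -> : derive1 (fun t => E b0 b1 t + (K0 + t *: K1)) =
      fun t => E1 b0 b1 t + K1.
    by apply/funext => t; rewrite derive1E; case: (dJ t).
  move=> t; have dJ1 := is_deriveD (dE1 b0 b1 t) (is_derive_cst K1 t (1 : R)).
  rewrite addr0 in dJ1; split.
  - have trK : \tr (K0 + t *: K1) = 0.
      by rewrite mxtraceD mxtraceZ trK0 trK1 mulr0 addr0.
    have trKM : \tr ((K0 + t *: K1) *m M) = 0.
      by rewrite mulmxDl -scalemxAl mxtraceD mxtraceZ trK0M trK1M mulr0 addr0.
    by rewrite mulmxDl mxtraceD [in RHS]mxtraceD trK trKM !addr0.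
  - by case: (dJ t).
  - by case: dJ1.
  - rewrite mulmxDl mxtraceD trE1M trK1M addr0 derive1E.
    by case: dJ1.
(* Necessity: the equation for [w], the trace of [J'] against [M], is solved first. *)
pose J1 := derive1 J.
have dJ t : is_derive t (1 : R) J (J1 t).
  have [_ Jd _ _] := JJ t.
  by apply: DeriveDef Jd _; rewrite -derive1E.
pose w t := \tr (J1 t *m M).
have dJ1 t : is_derive t (1 : R) J1
    (2 * w t / (n%:R + t ^+ 2 * c) *: (1%:M - t *: M^T)).
  have [_ _ J1d J2E] := JJ t.
  by apply: DeriveDef J1d _; rewrite -derive1E J2E.
have mulM (f : R -> 'M[R]_n) t df : is_derive t (1 : R) f df ->
    is_derive t (1 : R) (fun u => \tr (f u *m M)) (\tr (df *m M)).
  move=> dft; apply: is_derive_mxtrace.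
  apply: is_derive_eq (is_derive_mulmx dft (is_derive_cst M t (1 : R))) _.
  by rewrite mulmx0 addr0.
have pos u : 0 < n%:R + u ^+ 2 * c.
  by rewrite ltr_pwDl// mulr_ge0 ?sqr_ge0// ltW.
(* The trace of [(1 - t M^T) M] is [- t c], so the matrix equation closes up to a linear scalar
   one. *)
have dw t : is_derive t (1 : R) w (- (2 * t * c) / (n%:R + t ^+ 2 * c) * w t).
  apply: is_derive_eq (mulM _ _ _ (dJ1 t)) _.
  rewrite -scalemxAl mxtraceZ mulmxBl mul1mx -scalemxAl raddfB /= mxtraceZ.
  rewrite (mxtrace_square0 hM2) [\tr (M^T *m M)]mxtrace_mulC.
  rewrite -/(hs_inner M M) -/c.
  by field; rewrite gt_eqF.
(* [(n + c t ^ 2) w t] is a first integral of the trace equation. *)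
have wE t : w t = b' (w 0 / c) t * c.
  have dI u : is_derive u (1 : R) (fun v => (n%:R + v ^+ 2 * c) * w v) 0.
    apply: is_derive_eq (is_deriveM (is_derive_growth n%:R c u) (dw u)) _.
    rewrite -![_ *: _]/(_ * _).
    by field; rewrite gt_eqF.
  have := is_derive_0_is_cst t 0 dI; rewrite expr0n mul0r addr0 => wI.
  have -> : w t = n%:R * w 0 / (n%:R + t ^+ 2 * c).
    apply: (canRL (mulfK (lt0r_neq0 (pos t)))).
    by rewrite [LHS]mulrC; exact: wI.
  by rewrite /b'; field; rewrite !gt_eqF.
(* These constants match [\tr (J M)] and its derivative with [b c] and [b' c] at [t = 0], where
   [atan] vanishes and [b'] equals [b1]. *)
pose b1 := w 0 / c; pose b0 := \tr (J 0 *m M) / c.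
have trJM t : \tr (J t *m M) = b b0 b1 t * c.
  have dg u : is_derive u (1 : R)
      (fun v => \tr (J v *m M) - \tr (E b0 b1 v *m M)) 0.
    apply: is_derive_eq (is_deriveB (mulM _ _ _ (dJ u))
      (mulM _ _ _ (dE b0 b1 u))) _.
    by rewrite trE1M -/(w u) wE subrr.
  have := is_derive_0_is_cst t 0 dg; rewrite !trEM {2}/b mulr0 mul0r atan0.
  rewrite mulr0 add0r divfK ?gt_eqF// subrr => /eqP.
  by rewrite subr_eq0 => /eqP.
pose K t := J t - E b0 b1 t.
have dK u : is_derive u (1 : R) K (J1 u - E1 b0 b1 u).
  exact: is_deriveB (dJ u) (dE b0 b1 u).
(* Since [w = b' c], [J] and the ansatz have the same second derivative. *)
have dK1 u : is_derive u (1 : R) (fun v => J1 v - E1 b0 b1 v) 0.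
  apply: is_derive_eq (is_deriveB (dJ1 u) (dE1 b0 b1 u)) _.
  by rewrite wE subrr.
have KE := second_derive0_affine dK dK1.
have trK t : \tr (K t) = 0 /\ \tr (K t *m M) = 0.
  have KM : \tr (K t *m M) = 0.
    by rewrite mulmxBl raddfB /= trJM trEM subrr.
  split=> //; have [trJ _ _ _] := JJ t.
  by rewrite raddfB /= trJ trE trJM trEM subrr.
(* Writing the slope as a difference of two values of [K] puts it in the perpendicular space by
   linearity, without differentiating the trace conditions. *)
have K1E : J1 0 - E1 b0 b1 0 = K 1 - K 0.
  by rewrite (KE 1) scale1r [RHS]addrC addKr.
exists b0, b1, (K 0), (K 1 - K 0); split.
- by apply/(hs_perp1P _ hn hM2); exact: trK.
- apply/(hs_perp1P _ hn hM2); have [tr0 tr0M] := trK 0.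
  have [tr1 tr1M] := trK 1.
  split; first by rewrite raddfB /= tr0 tr1 subrr.
  by rewrite mulmxBl raddfB /= tr0M tr1M subrr.
- by move=> t; rewrite -/(b b0 b1 t) EE -addrA -K1E -KE addrC subrK.
Qed.
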